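(* Let $G$ be a connected finite simple graph. Then the following three conditions are equivalent. (1) $G$ has a $1$-factor. (2) $o(G \setminus S) \leqslant |S|$ for all $S \subseteq V(G)$. (3) $G$ is near-factor-critical.
   Context: All graphs are finite and simple, with vertex set $V(G)$ and edge set $E(G)$. A matching $M$ of $G$ is a subset of $E(G)$ such that no two edges in $M$ share a common endpoint. A matching $M$ saturates a vertex $v$ if $v$ is an endpoint of some edge in $M$. A $1$-factor (perfect matching) of $G$ is a matching that saturates every vertex of $G$. A near-factor of $G$ is a matching that saturates all vertices of $G$ except one (exactly one vertex is unsaturated). For $S \subseteq V(G)$, $G \setminus S$ denotes the graph obtained from $G$ by deleting all vertices of $S$; for a single vertex $v$, $G - v$ denotes $G \setminus \{v\}$. A graph $G$ is near-factor-critical if $G - v$ has a near-factor for every $v \in V(G)$. A component of a graph is a maximal connected subgraph; it is odd if it has an odd number of vertices. The number of odd components of a graph $G$ is denoted by $o(G)$. *)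

(* Defs.v *)
From mathcomp Require Import all_boot.

Set Implicit Arguments.
Unset Strict Implicit.
Unset Printing Implicit Defensive.

Record sgraph := SGraph {
  vertex :> finType;
  adj : rel vertex;
  adj_sym : symmetric adj;
  adj_irrefl : irreflexive adj
}.

(* An edge is the unordered pair of its endpoints. *)
Definition edges (G : sgraph) : {set {set G}} :=
  [set [set p.1; p.2] | p : G * G & adj p.1 p.2].

Definition induced_adj (G : sgraph) (A : {set G}) : rel {x : G | x \in A} :=
  fun x y => adj (val x) (val y).

Lemma induced_adj_sym (G : sgraph) (A : {set G}) : symmetric (@induced_adj G A).
Proof. by move=> x y; apply: adj_sym. Qed.

Lemma induced_adj_irrefl (G : sgraph) (A : {set G}) :
  irreflexive (@induced_adj G A).
Proof. by move=> x; apply: adj_irrefl. Qed.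

Definition induced (G : sgraph) (A : {set G}) : sgraph :=
  SGraph (@induced_adj_sym G A) (@induced_adj_irrefl G A).

Definition delete_vertices (G : sgraph) (S : {set G}) : sgraph := induced (~: S).

Definition delete_vertex (G : sgraph) (v : G) : sgraph := delete_vertices [set v].

Definition matching (G : sgraph) (M : {set {set G}}) : Prop :=
  M \subset edges G /\ {in M &, forall e f : {set G}, e != f -> [disjoint e & f]}.

Definition saturates (G : sgraph) (M : {set {set G}}) (v : G) : bool :=
  [exists e in M, v \in e].

Definition one_factor (G : sgraph) (M : {set {set G}}) : Prop :=
  matching M /\ forall v : G, saturates M v.

Definition near_factor (G : sgraph) (M : {set {set G}}) : Prop :=
  matching M /\ #|[set v : G | ~~ saturates M v]| = 1.

Definition has_one_factor (G : sgraph) : Prop :=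
  exists M : {set {set G}}, one_factor M.

Definition has_near_factor (G : sgraph) : Prop :=
  exists M : {set {set G}}, near_factor M.

Definition near_factor_critical (G : sgraph) : Prop :=
  forall v : G, has_near_factor (delete_vertex v).

(* The graph with no vertices counts as connected. *)
Definition connected (G : sgraph) : bool :=
  [forall x : G, forall y : G, connect (@adj G) x y].

(* A maximal connected subgraph is induced, so a component is identified with
   its vertex set; the graph with no vertices has no component. *)
Definition components (G : sgraph) : {set {set G}} :=
  [set C | maxset (fun A : {set G} => (A != set0) && connected (induced A)) C].

Definition odd_components (G : sgraph) : nat :=
  #|[set C in components G | odd #|C|]|.

(* Main.v *)
(** Everything rests on Gallai's argument: if every vertex is missed by some
    maximum matching, then the relation "no maximum matching misses both" is
    transitive, and it contains adjacency; so a maximum matching misses at most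
    one vertex of each component.  In a connected near-factor-critical graph
    without 1-factor, the near-factors of the graphs [G - v] are maximum
    matchings of [G] missing two vertices, one of them [v]: a contradiction.
    The Tutte-Berge formula follows by induction on the vertex set: a vertex
    covered by every maximum matching is moved to [S], and if there is none,
    Gallai's argument gives [S = set0]. *)

Require Import Defs.
From mathcomp Require Import all_boot.
From mathcomp Require Import zify.

Set Implicit Arguments.
Unset Strict Implicit.
Unset Printing Implicit Defensive.

(* A matching is encoded as an involution mapping each vertex to its partner,
   the unsaturated vertices being the fixed points. *)
Definition unmatched (T : finType) (f : {ffun T -> T}) : {set T} :=
  [set x | f x == x].

Definition mating (T : finType) (e : rel T) (f : {ffun T -> T}) : bool :=
  [forall x, (f (f x) == x) && ((f x != x) ==> e x (f x))].

Definition maximum_mating (T : finType) (e : rel T) (f : {ffun T -> T}) : bool :=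
  mating e f && [forall g, mating e g ==> (#|unmatched f| <= #|unmatched g|)].

(** * Maximum matchings as involutions, and Gallai's argument *)

Section Matings.

Variables (T : finType) (e : rel T).
Hypotheses (e_sym : symmetric e) (e_irr : irreflexive e).

Implicit Types (f g : {ffun T -> T}) (x y : T) (C : {set T}).

Lemma matingP f :
  reflect (involutive f /\ forall x, f x != x -> e x (f x)) (mating e f).
Proof.
apply: (iffP forallP) => [H|[fK fe] x].
  by split=> x; have /andP[/eqP //] := H x; move=> _ /implyP.
by rewrite fK eqxx; apply/implyP/fe.
Qed.

Lemma maximum_matingP f :
  reflect (mating e f /\ forall g, mating e g -> #|unmatched f| <= #|unmatched g|)
          (maximum_mating e f).
Proof.
apply: (iffP andP) => -[fm H]; split=> //.
  by move=> g gm; apply: (implyP (forallP H g)).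
by apply/forallP => g; apply/implyP/H.
Qed.

Lemma maximum_mating_exists : exists f, maximum_mating e f.
Proof.
have id_mating : mating e [ffun x => x].
  by apply/matingP; split=> x; rewrite !ffunE ?eqxx.
have [f fm fmin] := arg_minnP (fun f => #|unmatched f|) id_mating.
by exists f; apply/maximum_matingP.
Qed.

Lemma maximum_mating_card f g :
  maximum_mating e f -> mating e g -> #|unmatched g| <= #|unmatched f| ->
  maximum_mating e g.
Proof.
move=> /maximum_matingP[_ fmin] gm gf; apply/maximum_matingP; split=> // h hm.
exact: leq_trans gf (fmin h hm).
Qed.

(** The two-cycles of [f] inside [C] are removed one at a time; each removal takes two points and no
    fixed point. *)
Lemma card_involution_parity (f : T -> T) C :
  involutive f -> {in C, forall x, f x \in C} ->
  odd #|C| = odd #|[set x in C | f x == x]|.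
Proof.
move=> fK; have [n] := ubnP #|C|; elim: n C => // n IHn C Cn fC.
have [x /andP[xC fx]|Cfix] := pickP [pred x in C | f x != x]; last first.
  suff ->: [set x in C | f x == x] = C by [].
  apply/setP => x; rewrite inE; have := Cfix x => /=.
  by case: (x \in C) => //= /negbFE.
pose D := C :\ x :\ f x.
have fxCx : f x \in C :\ x by rewrite !inE fx fC.
have DC : #|C| = #|D|.+2 by rewrite (cardsD1 x) xC (cardsD1 (f x)) fxCx.
have fD : {in D, forall y, f y \in D}.
  move=> y; rewrite !inE => /and3P[yfx yx yC].
  rewrite fC // andbT (inj_eq (can_inj fK)) yx.
  by apply: contraNneq yfx => <-; rewrite fK.
rewrite DC /= negbK IHn //; last by rewrite DC in Cn; apply: ltnW.
congr (odd #|pred_of_set _|); apply/setP => y; rewrite !inE.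
have xfx : x == f x = false by rewrite eq_sym (negPf fx).
have [->|_] := eqVneq y (f x); first by rewrite fK xfx !andbF.
by have [->|] := eqVneq y x; rewrite //= (negPf fx) andbF.
Qed.

Lemma mating_parity f : mating e f -> odd #|unmatched f| = odd #|T|.
Proof.
move=> /matingP[fK _]; rewrite -cardsT (@card_involution_parity f [set: T]) //.
by congr (odd #|pred_of_set _|); apply/setP => y; rewrite !inE.
Qed.

(* The old partner of [y], if any, becomes unmatched. *)
Definition rematch f x y : {ffun T -> T} :=
  [ffun w => if w == x then y else if w == y then x else
             if w == f y then w else f w].

Lemma rematch_mating f x y :
  mating e f -> f x = x -> e x y -> mating e (rematch f x y).
Proof.
move=> /matingP[fK fe] fx exy.
have xy : x != y by apply: contraTneq exy => ->; rewrite e_irr.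
apply/matingP; split=> w; rewrite !ffunE.
  have [->|wx] := eqVneq w x; first by rewrite eq_sym (negPf xy) eqxx.
  have [->|wy] := eqVneq w y; first by rewrite eqxx.
  have [wfy|wfy] := eqVneq w (f y); first by rewrite (negPf wx) (negPf wy) wfy eqxx.
  have -> : f w == x = false by apply: contra_neqF wx => /eqP fwx; rewrite -(fK w) fwx fx.
  have -> : f w == y = false by apply: contra_neqF wfy => /eqP <-; rewrite fK.
  by rewrite (inj_eq (can_inj fK)) (negPf wy) fK.
have [-> //|wx] := eqVneq w x.
have [->|wy] := eqVneq w y; first by rewrite e_sym.
by have [|_] := eqVneq w (f y); [rewrite eqxx | apply: fe].
Qed.

Lemma unmatched_rematch f x y :
  involutive f -> f x = x -> x != y ->
  unmatched (rematch f x y) = (f y |: unmatched f) :\ x :\ y.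
Proof.
move=> fK fx xy; apply/setP => w; rewrite !inE !ffunE.
have [->|wx] := eqVneq w x; first by rewrite eq_sym (negPf xy) andbF.
have [->|wy] := eqVneq w y; first by rewrite (negPf xy).
by have [|_] := eqVneq w (f y); rewrite ?eqxx.
Qed.

(** Otherwise adding the edge [x y] would give a mating with fewer unmatched vertices. *)
Lemma maximum_mating_edge f x y :
  maximum_mating e f -> f x = x -> f y = y -> ~~ e x y.
Proof.
move=> /maximum_matingP[fm fmin] fx fy; apply/negP => exy.
have xy : x != y by apply: contraTneq exy => ->; rewrite e_irr.
have /matingP[fK _] := fm.
have := fmin _ (rematch_mating fm fx exy); rewrite unmatched_rematch // fy.
have yU : y \in unmatched f by rewrite inE fy.
have xU : x \in unmatched f by rewrite inE fx.
rewrite (setUidPr _) ?sub1set // (cardsD1 x) xU leqNgt ltnS.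
by rewrite subset_leq_card // subD1set.
Qed.

(** Gallai's relation. Concluding [x = y] rather than excluding [f] makes it reflexive, so that it
    can be chained along paths, the empty one included. *)
Definition tied x y : Prop :=
  forall f, maximum_mating e f -> f x = x -> f y = y -> x = y.

Lemma edge_tied x y : e x y -> tied x y.
Proof. by move=> exy f fm fx fy; rewrite (negPf (maximum_mating_edge fm fx fy)) in exy. Qed.

(* Given maximum matings [f] missing [u], [v] and [g] missing [t], some [x != t]
   is missed by [g] but not by [f]; matching [x] as [f] does keeps [g] maximum
   and missing [t], but increases its agreement with [f]. *)
Lemma tied_trans t u v :
  (exists2 f, maximum_mating e f & f t = t) -> tied u t -> tied t v -> tied u v.
Proof.
move=> [g0 g0m g0t] ut tv f fm fu fv; apply/eqP/negPn/negP => uv.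
(* If [f] missed [t] as well, then [u = t = v]. *)
have ft : f t != t.
  by apply: contra_neqN uv => /eqP ft; rewrite (ut f) // (tv f).
have tu : t != u by apply: contraNneq ft => ->; rewrite fu.
have tNv : t != v by apply: contraNneq ft => ->; rewrite fv.
pose missing_t g := maximum_mating e g && (g t == t).
have g0P : missing_t g0 by rewrite /missing_t g0m g0t eqxx.
case: (arg_maxnP (fun g => #|[set w | g w == f w]|) g0P) => g /andP[gm /eqP gt] gmax.
have gu : g u != u by apply: contra_neqN tu => /eqP gu; rewrite (ut g).
have gv : g v != v by apply: contra_neqN tNv => /eqP gv; rewrite (tv g).
have /maximum_matingP[fM fmin] := fm; have /maximum_matingP[gM gmin] := gm.
have /matingP[fK fe] := fM; have /matingP[gK ge] := gM.
have eqU : #|unmatched f| = #|unmatched g|.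
  by apply/eqP; rewrite eqn_leq fmin // gmin.
(* Both matings miss equally many vertices and [f] misses [u] and [v], which [g] covers; so [g]
   misses two vertices covered by [f]: [t] and a further [x]. *)
have : 1 < #|unmatched g :\: unmatched f|.
  have := cardsID (unmatched f) (unmatched g).
  have := cardsID (unmatched g) (unmatched f).
  rewrite setIC eqU => <- /addnI ->.
  have <- : #|[set u; v]| = 2 by rewrite cards2 uv.
  rewrite subset_leq_card //.
  by apply/subsetP => w; rewrite !inE => /orP[]/eqP ->; rewrite ?fu ?fv eqxx ?gu ?gv.
rewrite (cardsD1 t) !inE ft gt eqxx ltnS card_gt0 => /set0Pn[x].
rewrite !inE => /and3P[xt fx /eqP gx].
set y := f x in fx; have exy : e x y by apply: fe.
have fy : f y = x by rewrite /y fK.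
have xy : x != y by rewrite eq_sym.
have gy : g y != y.
  by apply: contraTneq exy => gy; apply: maximum_mating_edge gx gy.
have gyx : g y != x by apply: contra_neq xy => E; rewrite -(gK y) E gx.
have hM := rematch_mating gM gx exy.
set h := rematch g x y in hM.
have hm : missing_t h.
  apply/andP; split.
    (* The count does not grow: [h] covers [x] and frees [g y]. *)
    apply: maximum_mating_card gm hM _; rewrite unmatched_rematch //.
    have gyU : g y \notin unmatched g by rewrite inE gK eq_sym.
    have xU : x \in g y |: unmatched g by rewrite !inE gx eqxx orbT.
    have := cardsU1 (g y) (unmatched g); rewrite (cardsD1 x) xU gyU !add1n => -[<-].
    by rewrite subset_leq_card // subD1set.
  rewrite /h ffunE [t == x]eq_sym (negPf xt).
  have [ty|ty] := eqVneq t y; first by rewrite -ty gt eqxx in gy.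
  by case: ifP; rewrite ?gt eqxx.
have := gmax h hm; rewrite /geq /= leqNgt => /negP[]; apply: proper_card.
apply/properP; split; last first.
  by exists x; rewrite !inE ?gx // /h ffunE eqxx.
(* The agreement at [x] is new and none is lost: [h] agrees with [f] at [y], and [g] could agree
   with [f] at [g y] only if [g y = x]. *)
apply/subsetP => w; rewrite !inE /h ffunE => /eqP gw.
have [-> //|wx] := eqVneq w x.
have [->|wy] := eqVneq w y; first by rewrite fy.
have [wgy|_] := eqVneq w (g y); last by rewrite gw.
by case/eqP: wx; rewrite -(fK w) -gw wgy gK.
Qed.

(** Adjacent vertices are tied; the hypothesis that every vertex can be missed lets [tied_trans]
    pass through each inner vertex of a path. *)
Lemma connect_tied x y :
  (forall t, exists2 f, maximum_mating e f & f t = t) ->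
  connect e x y -> tied x y.
Proof.
move=> missable /connectP[p]; elim: p x => [|z p IHp] x /=.
  by move=> _ -> f.
move=> /andP[exz zp] yp.
exact: tied_trans (missable z) (edge_tied exz) (IHp _ zp yp).
Qed.

End Matings.

(** * Odd components and the Tutte-Berge formula *)

(** Vertices outside [B] are isolated rather than removed, so induction on the vertex set stays in
    one type. *)
Definition restrict (T : finType) (e : rel T) (B : {set T}) : rel T :=
  fun x y => [&& x \in B, y \in B & e x y].

Arguments restrict T e B x y /.

Definition component_of (T : finType) (e : rel T) (B : {set T}) (x : T) : {set T} :=
  [set y in B | connect (restrict e B) x y].

Definition odd_components_in (T : finType) (e : rel T) (B : {set T}) : {set {set T}} :=
  [set C in [set component_of e B x | x in B] | odd #|C|].

Section TutteBerge.

Variables (T : finType) (e : rel T).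
Hypotheses (e_sym : symmetric e) (e_irr : irreflexive e).

Implicit Types (f g : {ffun T -> T}) (A B C : {set T}).

Lemma restrict_sym B : symmetric (restrict e B).
Proof. by move=> x y; rewrite /= e_sym andbCA. Qed.

Lemma restrict_irr B : irreflexive (restrict e B).
Proof. by move=> x; rewrite /= e_irr !andbF. Qed.

Lemma restrict_mating A B f :
  A \subset B -> mating (restrict e A) f -> mating (restrict e B) f.
Proof.
move=> /subsetP AB /matingP[fK fe]; apply/matingP; split=> // x /fe /= /and3P[xA fxA].
by rewrite !AB.
Qed.

Lemma component_mating A f x :
  mating (restrict e A) f -> {in component_of e A x, forall y, f y \in component_of e A x}.
Proof.
move=> /matingP[_ fe] y; rewrite !inE => /andP[yA xy].
have [->|/fe efy] := eqVneq (f y) y; first by rewrite yA.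
have /and3P[_ -> _] := efy.
exact: connect_trans xy (connect1 efy).
Qed.

(** Mapping a missed vertex to its component is injective, since connected vertices are tied. The
    component is stable under [f] and contains just one fixed point, hence is odd. *)
Lemma missable_odd_components A f :
  maximum_mating (restrict e A) f ->
  (forall t, exists2 g, maximum_mating (restrict e A) g & g t = t) ->
  #|unmatched f :&: A| <= #|odd_components_in e A|.
Proof.
move=> fm missable; have /maximum_matingP[fM _] := fm; have /matingP[fK _] := fM.
have tie := connect_tied (@restrict_sym A) (@restrict_irr A) missable.
have inj : {in unmatched f :&: A &, injective (component_of e A)}.
  move=> x y; rewrite !inE => /andP[/eqP fx xA] /andP[/eqP fy yA] xy.
  have : y \in component_of e A x by rewrite xy inE yA connect0.
  by rewrite inE yA => /tie/(_ f fm); apply.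
rewrite -(card_in_imset inj) subset_leq_card //.
apply/subsetP => _ /imsetP[x /setIP[/[!inE]/eqP fx xA] ->].
rewrite imset_f //= (card_involution_parity fK (component_mating fM)).
rewrite (_ : [set _ in _ | _] = [set x]) ?cards1 //.
apply/setP => y; rewrite !inE; apply/idP/eqP => [/andP[/andP[yA xy] /eqP fy]|->].
  by rewrite (tie _ _ xy f).
by rewrite xA connect0 fx eqxx.
Qed.

(** The term [#|~: A|] accounts for the vertices outside [A], all of them fixed by [f]. *)
Lemma Tutte_Berge A :
  exists2 f, mating (restrict e A) f &
  exists2 S : {set T}, S \subset A &
    #|unmatched f| + #|S| <= #|odd_components_in e (A :\: S)| + #|~: A|.
Proof.
have [n] := ubnP #|A|; elim: n A => // n IHn A An.
have [f fm] := maximum_mating_exists (restrict e A).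
have /maximum_matingP[fM fmin] := fm; exists f => //.
have [/existsP[v /forallP vP]|] := boolP [exists v,
    [forall g, maximum_mating (restrict e A) g ==> (g v != v)]]; last first.
  move=> /existsPn missable; exists set0; first exact: sub0set.
  rewrite cards0 addn0 setD0 -(cardsID A) leq_add //; last first.
    by rewrite subset_leq_card // setDE subsetIr.
  apply: missable_odd_components => // t; have := missable t.
  by move=> /forallPn[g]; rewrite negb_imply negbK => /andP[gm /eqP gt]; exists g.
have vA : v \in A.
  have /matingP[_ fe] := fM.
  by have /fe /and3P[] := implyP (vP f) fm.
have [|g gM [S SA gS]] := IHn (A :\ v).
  by rewrite (cardsD1 v) vA in An.
have gMA : mating (restrict e A) g by apply: restrict_mating gM; apply: subD1set.
have gv : g v = v.
  have /matingP[_ ge] := gM; apply/eqP; apply: contraT => /ge /and3P[].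
  by rewrite !inE eqxx.
have vS : v \notin S by apply: contraL SA => vS; apply/subsetPn; exists v; rewrite ?inE ?eqxx.
exists (v |: S).
  by rewrite subUset sub1set vA (subset_trans SA) ?subD1set.
rewrite -setDDl cardsU1 vS.
have cA : #|~: (A :\ v)| = #|~: A|.+1.
  by rewrite setCD setUC cardsU1 inE vA.
(* [g] misses [v], which every maximum mating on [A] covers, so [g] is not maximum. *)
have lt_fg : #|unmatched f| < #|unmatched g|.
  rewrite ltnNge; apply/negP => gf.
  by have /negP[] := implyP (vP g) (maximum_mating_card fm gMA gf); apply/eqP.
(* Parity widens the gap to two: one unit pays for [v] entering [S], the other for [v] counting
   outside [A :\ v]. *)
have : odd #|unmatched f| = odd #|unmatched g|.
  by rewrite (mating_parity fM) (mating_parity gMA).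
lia.
Qed.

End TutteBerge.

(** * Edge-set matchings versus involutions *)

Section Graphs.

Implicit Type G : sgraph.

Lemma mating_matching G (f : {ffun G -> G}) : mating (@adj G) f ->
  exists2 M : {set {set G}}, matching M & forall v, saturates M v = (f v != v).
Proof.
move=> /matingP[fK fe].
exists [set [set x; f x] | x in [set x | f x != x]].
  split.
    apply/subsetP => _ /imsetP[x /[!inE] /fe efx ->].
    by apply/imsetP; exists (x, f x); rewrite ?inE.
  move=> _ _ /imsetP[x _ ->] /imsetP[y _ ->]; apply: contra_neqT.
  rewrite -setI_eq0 => /set0Pn[z /setIP[]].
  (* An orbit of [f] is determined by any of its points, so orbits that meet coincide. *)
  have pairE u : z \in [set u; f u] -> [set u; f u] = [set z; f z].
    by rewrite !inE => /orP[]/eqP -> //; rewrite fK setUC.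
  by move=> /pairE -> /pairE ->.
move=> v; apply/exists_inP/idP => [[_ /imsetP[x /[!inE] fx ->]]|fv].
  by rewrite !inE => /orP[]/eqP ->; rewrite ?fK // eq_sym.
by exists [set v; f v]; [apply: imset_f; rewrite inE | rewrite !inE eqxx].
Qed.

Lemma matching_mating G (M : {set {set G}}) : matching M ->
  exists2 f : {ffun G -> G}, mating (@adj G) f & forall v, saturates M v = (f v != v).
Proof.
move=> [/subsetP Medge Mdisj].
have same C D x : C \in M -> D \in M -> x \in C -> x \in D -> C = D.
  move=> CM DM xC xD; apply/eqP; apply: contraT => /(Mdisj _ _ CM DM)/disjointFr/(_ xC).
  by rewrite xD.
have MadjP x y : [set x; y] \in M -> adj x y.
  move=> /Medge /imsetP[[a b] /[!inE]/= ab E].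
  have : a \in [set x; y] by rewrite E !inE eqxx.
  have : b \in [set x; y] by rewrite E !inE eqxx orbT.
  rewrite !inE => /orP[]/eqP bE /orP[]/eqP aE; move: ab; rewrite aE bE ?adj_irrefl //.
  by rewrite adj_sym.
(* The default [x] turns unsaturated vertices into fixed points; by disjointness [pick] has at most
   one candidate. *)
pose f := [ffun x : G => odflt x [pick y | [set x; y] \in M]].
have fE x y : [set x; y] \in M -> f x = y.
  move=> xyM; rewrite ffunE; case: pickP => [z xzM|/(_ y)] /=; last by rewrite xyM.
  have xy := MadjP _ _ xyM; have xz := MadjP _ _ xzM.
  have : z \in [set x; y].
    by rewrite (same _ _ x xyM xzM) ?inE ?eqxx ?orbT.
  by rewrite !inE => /orP[]/eqP // zx; rewrite zx adj_irrefl in xz.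
have fP x : f x != x -> [set x; f x] \in M.
  by rewrite ffunE; case: pickP => [z //|_] /=; rewrite eqxx.
exists f.
  apply/matingP; split=> [x|x /fP /MadjP //].
  by have [fx|/fP fx] := eqVneq (f x) x; [rewrite !fx | apply: fE; rewrite setUC].
move=> v; apply/exists_inP/idP => [[C CM vC]|/fP fv]; last first.
  by exists [set v; f v]; rewrite // !inE eqxx.
have [w vwM] : exists w, [set v; w] \in M.
  have /imsetP[[a b] _ /= E] := Medge C CM.
  move: vC; rewrite E !inE => /orP[]/eqP ->; first by exists b; rewrite -E.
  by exists a; rewrite setUC -E.
rewrite (fE _ _ vwM); apply: contraTneq (MadjP _ _ vwM) => ->.
by rewrite adj_irrefl.
Qed.

Lemma has_one_factorP G :
  has_one_factor G <->
  exists2 f : {ffun G -> G}, mating (@adj G) f & unmatched f = set0.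
Proof.
split=> [[M [/matching_mating[f fM satE] sat]]|[f /mating_matching[M Mm satE] f0]].
  exists f => //; apply/setP => v; rewrite !inE; apply: negbTE.
  by rewrite -satE.
exists M; split=> // v; rewrite satE; have /setP/(_ v) := f0.
by rewrite !inE => ->.
Qed.

Lemma has_near_factorP G :
  has_near_factor G <->
  exists2 f : {ffun G -> G}, mating (@adj G) f & #|unmatched f| = 1.
Proof.
split=> [[M [/matching_mating[f fM satE] M1]]|[f /mating_matching[M Mm satE] f1]].
  exists f => //; rewrite -M1; congr #|pred_of_set _|; apply/setP => v.
  by rewrite !inE satE negbK.
exists M; split=> //; rewrite -f1; congr #|pred_of_set _|; apply/setP => v.
by rewrite !inE satE negbK.
Qed.

(** * Components as reachability classes *)

Lemma connect_induced G (B : {set G}) (x y : induced B) :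
  connect (@adj (induced B)) x y = connect (restrict (@adj G) B) (val x) (val y).
Proof.
apply/idP/idP => /connectP[p].
  elim: p x => [|z p IHp] x /=; first by move=> _ ->.
  move=> /andP[xz zp] yp; apply: connect_trans (IHp _ zp yp).
  by apply: connect1; rewrite /= (valP x) (valP z).
elim: p x => [|z p IHp] x /=; first by move=> _ /val_inj ->.
move=> /andP[/and3P[xB zB xz] zp] yp.
apply: connect_trans (IHp (Sub z zB) zp yp).
exact: connect1.
Qed.

Lemma connect_restrict_component G (x y : G) :
  connect (@adj G) x y ->
  connect (restrict (@adj G) [set z | connect (@adj G) x z]) x y.
Proof.
move=> /connectP[p]; set B := [set z | _].
have : x \in B by rewrite inE.
(* The start of the path is generalized while [B] remains the class of the original [x]. *)
elim: p {1 2 3 4}x => [|z p IHp] w /=; first by move=> _ _ ->.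
move=> wB /andP[wz zp] yp.
have zB : z \in B by move: wB; rewrite !inE => xw; apply: connect_trans xw (connect1 wz).
apply: connect_trans (IHp z zB zp yp); apply: connect1.
by rewrite /= wB zB.
Qed.

Lemma connected_inducedP G (A : {set G}) :
  reflect {in A &, forall x y, connect (restrict (@adj G) A) x y}
          (connected (induced A)).
Proof.
apply: (iffP forallP) => [H x y xA yA|H x].
  by have := forallP (H (Sub x xA)) (Sub y yA); rewrite connect_induced.
by apply/forallP => y; rewrite connect_induced H //; apply: valP.
Qed.

Lemma connected_component G (x : G) :
  connected (induced [set y | connect (@adj G) x y]).
Proof.
apply/connected_inducedP => y z; rewrite !inE => /connect_restrict_component xy xz.
apply: connect_trans (connect_restrict_component xz).
by rewrite (sym_connect_sym (restrict_sym (@adj_sym G) _)).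
Qed.

Lemma connected_sub_component G (A : {set G}) x :
  x \in A -> connected (induced A) -> A \subset [set y | connect (@adj G) x y].
Proof.
move=> xA /connected_inducedP A_conn; apply/subsetP => y yA; rewrite inE.
by apply: connect_sub (A_conn x y xA yA) => a b /and3P[_ _ ab]; apply: connect1.
Qed.

(** A reachability class is connected and contains every connected set through any of its points, so
    these classes are the maximal connected sets. *)
Lemma componentsE G :
  components G = [set [set y | connect (@adj G) x y] | x : G].
Proof.
apply/setP => C; rewrite inE; apply/idP/imsetP.
  move=> /maxsetP[/andP[/set0Pn[x xC] C_conn] Cmax]; exists x => //.
  rewrite (Cmax [set y | connect (@adj G) x y]) ?connected_sub_component //.
  by rewrite connected_component andbT; apply/set0Pn; exists x; rewrite inE.
move=> [x _ ->]; apply/maxsetP; split.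
  by rewrite connected_component andbT; apply/set0Pn; exists x; rewrite inE.
move=> D /andP[_ D_conn] xD; apply/eqP; rewrite eqEsubset xD andbT.
by apply: connected_sub_component => //; apply: (subsetP xD); rewrite inE.
Qed.

Lemma odd_components_inducedE G (B : {set G}) :
  odd_components (induced B) = #|odd_components_in (@adj G) B|.
Proof.
(* Images under [val] bring both families into [{set {set G}}] and preserve cardinalities. *)
rewrite /odd_components -(card_imset _ (imset_inj val_inj)).
have imE (x : induced B) :
    val @: [set y | connect (@adj (induced B)) x y] = component_of (@adj G) B (val x).
  apply/setP => y; rewrite inE; apply/imsetP/andP.
    by move=> [z /[!inE] xz ->]; rewrite -connect_induced (valP z).
  by move=> [yB xy]; exists (Sub y yB); rewrite // inE connect_induced.
congr #|pred_of_set _|; apply/setP => C; apply/imsetP/idP.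
  move=> [D]; rewrite inE componentsE => /andP[/imsetP[x _ ->] xodd] ->.
  rewrite inE card_imset ?xodd; last exact: val_inj.
  by rewrite imE imset_f ?(valP x).
rewrite inE => /andP[/imsetP[x xB ->] xodd].
exists [set y | connect (@adj (induced B)) (Sub x xB) y]; last by rewrite imE.
rewrite inE componentsE imset_f //= -(card_imset _ val_inj).
by rewrite imE.
Qed.

(** * The implications between the three conditions *)

(** By parity the 1-factor cannot match an odd component within itself, so one of its edges leads
    into [S]. The endpoint [s] in [S] determines the component, namely that of [f s]. *)
Lemma one_factor_odd_components G (S : {set G}) :
  has_one_factor G -> odd_components (delete_vertices S) <= #|S|.
Proof.
move=> /has_one_factorP[f /matingP[fK fe] f0].
rewrite odd_components_inducedE; set P := odd_components_in _ _.
have exit C : C \in P -> exists x, (x \in C) && (f x \in S).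
  rewrite inE => /andP[/imsetP[x xS ->] Codd]; set C0 := component_of _ _ _ in Codd *.
  apply/existsP; apply: contraTT Codd => /existsPn noexit.
  rewrite (card_involution_parity fK) => [|y yC].
    rewrite (_ : [set _ in _ | _] = set0) ?cards0 //; apply/setP => y.
    by have /setP/(_ y) := f0; rewrite !inE => ->; rewrite andbF.
  have := noexit y; rewrite yC /= => fyS.
  have /fe yfy : f y != y by have /setP/(_ y) := f0; rewrite !inE => ->.
  move: yC; rewrite !inE => /andP[yS xy]; rewrite fyS.
  by apply: connect_trans xy _; apply: connect1; rewrite /= !inE yS fyS.
have componentE C x : C \in P -> x \in C -> C = component_of (@adj G) (~: S) x.
  rewrite inE => /andP[/imsetP[z zS ->] _]; rewrite inE => /andP[xS zx].
  apply/setP => y; rewrite !inE; congr (_ && _).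
  by rewrite (same_connect (sym_connect_sym (restrict_sym (@adj_sym G) _)) zx).
have sub : P \subset [set component_of (@adj G) (~: S) (f s) | s in S].
  apply/subsetP => C CP; have [x /andP[xC fxS]] := exit C CP.
  by apply/imsetP; exists (f x); rewrite // fK -(componentE C).
exact: leq_trans (subset_leq_card sub) (leq_imset_card _ _).
Qed.

(** Tutte-Berge on the whole vertex set gives an [S] for which the hypothesis leaves no room for
    unmatched vertices. *)
Lemma odd_components_one_factor G :
  (forall S : {set G}, odd_components (delete_vertices S) <= #|S|) ->
  has_one_factor G.
Proof.
move=> tutte; apply/has_one_factorP.
have [f fM [S _]] := Tutte_Berge (@adj_sym G) (@adj_irrefl G) [set: G].
rewrite setTD setCT cards0 addn0 -odd_components_inducedE.
move=> /leq_trans/(_ (tutte S)); rewrite -[leqRHS]add0n leq_add2r leqn0 cards_eq0.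
move=> /eqP f0; exists f => //; have /matingP[fK fe] := fM.
by apply/matingP; split=> // x /fe /and3P[].
Qed.

Lemma one_factor_near_factor_critical G :
  has_one_factor G -> near_factor_critical G.
Proof.
move=> /has_one_factorP[f /matingP[fK fe] f0] v; apply/has_near_factorP.
have fx x : f x != x by have /setP/(_ x) := f0; rewrite !inE => ->.
(* The default of [insubd] applies just when the partner is [v], so [f v] becomes the only fixed
   point. *)
pose g := [ffun x : delete_vertex v => insubd x (f (val x))].
have gE x : val (g x) = if f (val x) == v then val x else f (val x).
  by rewrite ffunE val_insubd !inE; case: eqP.
exists g.
  apply/matingP; split=> x; last first.
    rewrite -val_eqE -[adj x _]/(adj (val x) (val (g x))) gE.
    by case: ifP => [_|_ _]; [rewrite eqxx | apply: fe].
  apply: val_inj; rewrite !gE; have [fxv|fxv] := eqVneq (f (val x)) v.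
    by rewrite fxv eqxx.
  by rewrite fK; have := valP x; rewrite !inE => /negPf ->.
have fv : f v \in ~: [set v] by rewrite !inE fx.
rewrite (_ : unmatched g = [set Sub (f v) fv]) ?cards1 //.
apply/setP => x; rewrite !inE -!val_eqE gE /= -(inj_eq (can_inj fK) (val x)) fK.
by have [|_] := eqVneq (f (val x)) v; [rewrite eqxx | rewrite (negPf (fx _))].
Qed.

Lemma near_factor_extend G (v : G) : has_near_factor (delete_vertex v) ->
  exists2 g : {ffun G -> G}, mating (@adj G) g & g v = v /\ #|unmatched g| = 2.
Proof.
move=> /has_near_factorP[f /matingP[fK fe] f1].
(* [insub] fails only at [v], which is thereby left unmatched beside the vertex missed by the
   near-factor. *)
pose g : {ffun G -> G} := [ffun x => if insub x is Some y then val (f y) else x].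
have gv : g v = v by rewrite ffunE insubF // !inE eqxx.
have gE y : g (val y) = val (f y) by rewrite ffunE valK.
have split_v (x : G) : x = v \/ exists y : delete_vertex v, x = val y.
  have [|xv] := eqVneq x v; [by left | right].
  have xP : x \in ~: [set v] by rewrite !inE.
  by exists (Sub x xP).
exists g; last split=> //.
  apply/matingP; split=> x; case: (split_v x) => [->|[y ->]].
  - by rewrite !gv.
  - by rewrite !gE fK.
  - by rewrite gv eqxx.
  - by rewrite gE val_eqE => /fe.
have -> : unmatched g = v |: val @: unmatched f.
  apply/setP => x; rewrite !inE; case: (split_v x) => [->|[y ->]].
    by rewrite gv !eqxx.
  have -> : (val y == v) = false by have := valP y; rewrite !inE => /negPf.
  by rewrite (mem_imset _ _ val_inj) inE gE val_eqE.
rewrite cardsU1 card_imset ?f1; last exact: val_inj.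
suff -> : v \notin val @: unmatched f by [].
by apply/imsetP => -[y _ vy]; have := valP y; rewrite !inE -vy eqxx.
Qed.

Lemma near_factor_critical_one_factor G :
  connected G -> near_factor_critical G -> has_one_factor G.
Proof.
move=> G_conn crit; apply/has_one_factorP.
have [f fm] := maximum_mating_exists (@adj G).
have /maximum_matingP[fM _] := fm; exists f => //.
apply/eqP/negPn/negP => /set0Pn[x xU].
(* The number of missed vertices has the parity of the order of [G], and an extended near-factor
   misses two. *)
have even_f : ~~ odd #|unmatched f|.
  have [g gM [_ g2]] := near_factor_extend (crit x).
  by rewrite (mating_parity fM) -(mating_parity gM) g2.
have f2 : 1 < #|unmatched f|.
  have : 0 < #|unmatched f| by apply/card_gt0P; exists x.
  by case: #|_| even_f => [|[]].
(* The maximum mating [f] misses at least two vertices, so an extended near-factor, missing two, is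
   maximum. *)
have missable t : exists2 g, maximum_mating (@adj G) g & g t = t.
  have [g gM [gt g2]] := near_factor_extend (crit t); exists g => //.
  by apply: maximum_mating_card fm gM _; rewrite g2.
have [y [z [yU zU]]] := card_gt1P f2; case/negP; apply/eqP.
rewrite !inE in yU zU.
apply: (connect_tied (@adj_sym G) (@adj_irrefl G) missable _ fm); try exact/eqP.
exact: (forallP (forallP G_conn y) z).
Qed.

End Graphs.

Theorem theorem2 (G : sgraph) (Gconn : connected G) :
  [<-> has_one_factor G;
       forall S : {set G}, odd_components (delete_vertices S) <= #|S|;
       near_factor_critical G].
Proof.
tfae.
- by move=> G1 S; apply: one_factor_odd_components.
- by move=> /odd_components_one_factor /one_factor_near_factor_critical.
- exact: near_factor_critical_one_factor.
Qed.
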